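(* There exist effectively inseparable distributive pre-lattices that are not $\mathcal{L}^d$-universal, where $\mathcal{L}^d$ is the class of c.e. distributive pre-lattices.
   Context: $W_u$ denotes the $u$-th c.e. set. A c.e. pre-lattice is a structure $L=\langle\omega,\wedge,\vee,\leq_L\rangle$ with $\wedge,\vee$ computable binary operations and $\leq_L$ a c.e. pre-ordering (reflexive transitive) relation, such that the equivalence relation $\equiv_L$ ($x\equiv_L y$ iff $x\leq_L y$ and $y\leq_L x$) is a congruence and the quotient $L/{\equiv_L}$, ordered by the partial order induced by $\leq_L$, is a lattice in which $\wedge$ and $\vee$ induce meet and join. It is distributive if the quotient lattice is. A c.e. bounded pre-lattice $\langle\omega,\wedge,\vee,0,1,\leq_L\rangle$ is a c.e. pre-lattice in which $[0]_L$ and $[1]_L$ (the $\equiv_L$-classes of $0$ and $1$) are the least and greatest elements of the quotient. All pre-orders are assumed non-trivial (quotient with more than one element). A disjoint pair $(A,B)$ of sets is effectively inseparable (e.i.) if there is a partial computable function $\phi(u,v)$ such that whenever $A\subseteq W_u$, $B\subseteq W_v$ and $W_u\cap W_v=\emptyset$, then $\phi(u,v)$ is defined and $\phi(u,v)\notin W_u\cup W_v$. An effectively inseparable pre-lattice is a c.e. bounded pre-lattice $L$ such that the pair $([0]_L,[1]_L)$ is e.i. A c.e. distributive pre-lattice $L_2$ (forgetting $0,1$ if it is bounded) is $\mathcal{L}^d$-universal if for every c.e. distributive pre-lattice $L_1$ there is a computable function $f$ such that for all $x,y$: $x\leq_{L_1}y$ iff $f(x)\leq_{L_2}f(y)$,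 $f(x\vee_1 y)\equiv_{L_2}f(x)\vee_2 f(y)$, and $f(x\wedge_1 y)\equiv_{L_2}f(x)\wedge_2 f(y)$ (no preservation of bounds is required). *)

(* Defs.v *)
From Stdlib Require Import Arith Cantor.

(** Partial computable functions are the unary partial functions on [nat]
    obtained from the basic ones by composition, pairing, primitive recursion
    and minimization; functions of several arguments are coded by the Cantor
    bijection [Cantor.to_nat]. *)

Notation pairn x y := (Cantor.to_nat (x, y)).
Notation leftn n := (fst (Cantor.of_nat n)).
Notation rightn n := (snd (Cantor.of_nat n)).

Inductive code : Type :=
| Zero | Succ | Left | Right
| Pair (f g : code)
| Comp (f g : code)
| Prec (f g : code)
| Mu (f : code).

(** Partial functions are given by their graphs.  [prec_graph F G a] is the
    graph of h with h(0) = F(a) and h(m+1) = G(a, (m, h(m))); [mu_graph F a] is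
    the graph of the least y with F(a, y) = 0, where F(a, z) must be defined for
    every z < y. *)

Definition prec_graph (F G : nat -> nat -> Prop) (a : nat) :
    nat -> nat -> Prop :=
  fix h m y :=
    match m with
    | 0 => F a y
    | S m' => exists i, h m' i /\ G (pairn a (pairn m' i)) y
    end.

Definition mu_graph (F : nat -> nat -> Prop) (a y : nat) : Prop :=
  F (pairn a y) 0 /\ forall z, z < y -> exists k, F (pairn a z) (S k).

Fixpoint eval (c : code) (n y : nat) : Prop :=
  match c with
  | Zero => y = 0
  | Succ => y = S n
  | Left => y = leftn n
  | Right => y = rightn n
  | Pair f g => exists a b, eval f n a /\ eval g n b /\ y = pairn a b
  | Comp f g => exists z, eval g n z /\ eval f z y
  | Prec f g => prec_graph (eval f) (eval g) (leftn n) (rightn n) y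
  | Mu f => mu_graph (eval f) n y
  end.

Fixpoint encode (c : code) : nat :=
  match c with
  | Zero => pairn 0 0
  | Succ => pairn 1 0
  | Left => pairn 2 0
  | Right => pairn 3 0
  | Pair f g => pairn 4 (pairn (encode f) (encode g))
  | Comp f g => pairn 5 (pairn (encode f) (encode g))
  | Prec f g => pairn 6 (pairn (encode f) (encode g))
  | Mu f => pairn 7 (encode f)
  end.

Lemma pairn_inj (a b a' b' : nat) :
  pairn a b = pairn a' b' -> a = a' /\ b = b'.
Proof.
  intros H; apply Cantor.to_nat_inj in H.
  split; [exact (f_equal fst H) | exact (f_equal snd H)].
Qed.

Lemma encode_inj (c d : code) : encode c = encode d -> c = d.
Proof.
  revert d; induction c; intros d H; destruct d; cbn [encode] in H;
    apply pairn_inj in H; destruct H as [Ht H];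
    try discriminate Ht; try reflexivity;
    try (apply pairn_inj in H; destruct H); f_equal; auto.
Qed.

Lemma eval_fun (c : code) (n y y' : nat) : eval c n y -> eval c n y' -> y = y'.
Proof.
  revert n y y'; induction c as [| | | |f IHf g IHg|f IHf g IHg|f IHf g IHg|f IHf];
    intros n y y'; simpl; try congruence.
  - intros (a & b & Ha & Hb & ->) (a' & b' & Ha' & Hb' & ->).
    now rewrite (IHf _ _ _ Ha Ha'), (IHg _ _ _ Hb Hb').
  - intros (z & Hz & Hy) (z' & Hz' & Hy').
    rewrite (IHg _ _ _ Hz' Hz) in Hy'; eauto.
  - generalize (leftn n) (rightn n); intros a m; revert y y'.
    induction m as [|m IHm]; simpl; intros y y'.
    + apply IHf.
    + intros (i & Hi & Hy) (i' & Hi' & Hy').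
      rewrite (IHm _ _ Hi' Hi) in Hy'; eauto.
  - intros [H0 Hlt] [H0' Hlt'].
    destruct (Nat.lt_total y y') as [H | [H | H]]; auto.
    + destruct (Hlt' _ H) as [k Hk]; discriminate (IHf _ _ _ H0 Hk).
    + destruct (Hlt _ H) as [k Hk]; discriminate (IHf _ _ _ H0' Hk).
Qed.

(** The [u]-th c.e. set: the domain of the [u]-th partial computable function,
    empty when [u] is not the number of a code. *)
Definition W (u x : nat) : Prop :=
  exists c, encode c = u /\ exists y, eval c x y.

Definition computable1 (f : nat -> nat) : Prop :=
  exists c, forall x, eval c x (f x).

Definition computable2 (f : nat -> nat -> nat) : Prop :=
  exists c, forall x y, eval c (pairn x y) (f x y).

Definition ce_rel (R : nat -> nat -> Prop) : Prop :=
  exists u, forall x y, R x y <-> W u (pairn x y).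

Definition effectively_inseparable (A B : nat -> Prop) : Prop :=
  (forall x, ~ (A x /\ B x)) /\
  exists phi : code, forall u v,
    (forall x, A x -> W u x) ->
    (forall x, B x -> W v x) ->
    (forall x, ~ (W u x /\ W v x)) ->
    exists z, eval phi (pairn u v) z /\ ~ (W u z \/ W v z).

Definition equiv_of (le : nat -> nat -> Prop) (x y : nat) : Prop :=
  le x y /\ le y x.

(** The lattice structure of the quotient is expressed on representatives. *)
Record ce_prelattice : Type := {
  meet : nat -> nat -> nat;
  join : nat -> nat -> nat;
  le : nat -> nat -> Prop;
  meet_computable : computable2 meet;
  join_computable : computable2 join;
  le_ce : ce_rel le;
  le_refl : forall x, le x x;
  le_trans : forall x y z, le x y -> le y z -> le x z;
  meet_congr : forall x x' y y', equiv_of le x x' -> equiv_of le y y' ->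
    equiv_of le (meet x y) (meet x' y');
  join_congr : forall x x' y y', equiv_of le x x' -> equiv_of le y y' ->
    equiv_of le (join x y) (join x' y');
  meet_lb_l : forall x y, le (meet x y) x;
  meet_lb_r : forall x y, le (meet x y) y;
  meet_glb : forall x y z, le z x -> le z y -> le z (meet x y);
  join_ub_l : forall x y, le x (join x y);
  join_ub_r : forall x y, le y (join x y);
  join_lub : forall x y z, le x z -> le y z -> le (join x y) z;
  nontrivial : exists x y, ~ equiv_of le x y
}.

Definition eqv (L : ce_prelattice) : nat -> nat -> Prop := equiv_of (le L).

Definition distributive (L : ce_prelattice) : Prop :=
  forall x y z,
    eqv L (meet L x (join L y z)) (join L (meet L x y) (meet L x z)).

Record ce_bounded_prelattice : Type := {
  prelattice :> ce_prelattice;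
  bot : nat;
  top : nat;
  bot_le : forall x, le prelattice bot x;
  le_top : forall x, le prelattice x top
}.

Definition ei_prelattice (L : ce_bounded_prelattice) : Prop :=
  effectively_inseparable (fun x => eqv L x (bot L)) (fun x => eqv L x (top L)).

Definition lattice_reduction (L1 L2 : ce_prelattice) (f : nat -> nat) : Prop :=
  computable1 f /\
  (forall x y, le L1 x y <-> le L2 (f x) (f y)) /\
  (forall x y, eqv L2 (f (join L1 x y)) (join L2 (f x) (f y))) /\
  (forall x y, eqv L2 (f (meet L1 x y)) (meet L2 (f x) (f y))).

(** Universality for the class of c.e. distributive pre-lattices, to which the
    universal object itself must belong. *)
Definition Ld_universal (L2 : ce_prelattice) : Prop :=
  distributive L2 /\
  forall L1 : ce_prelattice, distributive L1 ->
    exists f, lattice_reduction L1 L2 f.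

(* Main.v *)
From Stdlib Require Import Arith Cantor List Lia Classical.
Require Import Defs.
Import ListNotations.

(** Consider the distributive lattices presented by generators and relations.
    As an inductive definition with semidecidable rules defines a semidecidable
    set ([semidec_closure]), the order of such a lattice is c.e. when its
    relations are ([semidec_pres_le]). The same principle yields a universal
    machine ([universal_machine]).

    The lattice of the theorem is free as a bounded distributive lattice, except
    that some generators are identified with the bounds. Each pair [u], [v]
    owns a generator, which is made greatest if a search finds it in [W u] first,
    and least if the search finds it in [W v] first ([race]). If [W u] contains
    the class of 0, [W v] contains the class of 1, and the generator is in one of
    them, then it is in both: the set that wins the race contains it, and the
    collapse puts it into the other. So that generator witnesses effective
    inseparability.

    Since the relations only collapse generators to the bounds, the lattice
    keeps a property of free distributive lattices: for no [b] does it have an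
    infinite family of elements that are not below [b] but have all their
    pairwise meets below [b] ([collapse_no_disjoint_family]). Indeed, each member
    of such a family lies above a meet of finitely many atoms that is not below
    [b] ([meets_dense]). Now [b] depends on finitely many atoms only
    ([sat_support]), so two of these finite sets of atoms agree on the support of
    [b] ([lists_agree]). The valuation that makes true the atoms of both sets then
    refutes [b] exactly as the first set does, but it satisfies the two members
    and hence their meet.

    On the other hand, the distributive lattice generated by infinitely many
    elements with pairwise meets 0 is c.e., and it has such a family, with [b]
    equal to 0. An embedding into the collapsed lattice would carry that family
    over, so there is none, computable or not. *)

Arguments Cantor.to_nat : simpl never.
Arguments Cantor.of_nat : simpl never.
Opaque Cantor.to_nat Cantor.of_nat.

(** * Computable functions *)

Lemma leftn_pairn (a b : nat) : leftn (pairn a b) = a.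
Proof. now rewrite Cantor.cancel_of_to. Qed.

Lemma rightn_pairn (a b : nat) : rightn (pairn a b) = b.
Proof. now rewrite Cantor.cancel_of_to. Qed.

Lemma pairn_leftn_rightn (n : nat) : pairn (leftn n) (rightn n) = n.
Proof. now rewrite <- surjective_pairing, Cantor.cancel_to_of. Qed.

Lemma computable_ext (f g : nat -> nat) :
  (forall n, f n = g n) -> computable1 f -> computable1 g.
Proof. intros E [c Hc]; exists c; intros n; rewrite <- E; apply Hc. Qed.

Lemma computable_id : computable1 (fun n => n).
Proof.
  exists (Pair Left Right); intros n; simpl.
  now exists (leftn n), (rightn n); rewrite pairn_leftn_rightn.
Qed.

Lemma computable_succ (f : nat -> nat) :
  computable1 f -> computable1 (fun n => S (f n)).
Proof. intros [c Hc]; exists (Comp Succ c); intros n; exists (f n); now split. Qed.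

Lemma computable_const (k : nat) : computable1 (fun _ => k).
Proof.
  induction k as [|k IH].
  - now exists Zero.
  - now apply computable_succ in IH.
Qed.

Lemma computable_left (f : nat -> nat) :
  computable1 f -> computable1 (fun n => leftn (f n)).
Proof. intros [c Hc]; exists (Comp Left c); intros n; exists (f n); now split. Qed.

Lemma computable_right (f : nat -> nat) :
  computable1 f -> computable1 (fun n => rightn (f n)).
Proof. intros [c Hc]; exists (Comp Right c); intros n; exists (f n); now split. Qed.

Lemma computable_pair (f g : nat -> nat) :
  computable1 f -> computable1 g -> computable1 (fun n => pairn (f n) (g n)).
Proof.
  intros [c Hc] [d Hd]; exists (Pair c d); intros n.
  exists (f n), (g n); now repeat split.
Qed.

Lemma computable_comp (t f : nat -> nat) :
  computable1 t -> computable1 f -> computable1 (fun n => t (f n)).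
Proof. intros [c Hc] [d Hd]; exists (Comp c d); intros n; exists (f n); now split. Qed.

(** Primitive recursion with parameter [a n]. *)
Lemma computable_rec (b s a m : nat -> nat) :
  computable1 b -> computable1 s -> computable1 a -> computable1 m ->
  computable1 (fun n =>
    nat_rect (fun _ => nat) (b (a n))
      (fun k r => s (pairn (a n) (pairn k r))) (m n)).
Proof.
  intros [cb Hb] [cs Hs] [ca Ha] [cm Hm].
  exists (Comp (Prec cb cs) (Pair ca cm)); intros n.
  exists (pairn (a n) (m n)); split.
  { exists (a n), (m n); now repeat split. }
  simpl; rewrite leftn_pairn, rightn_pairn.
  induction (m n) as [|k IH]; simpl; [apply Hb|].
  eexists; split; [exact IH | apply Hs].
Qed.

(** [ifz a b c] is [b] when [a] is zero and [c] otherwise: zero plays the role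
    of truth. *)
Definition ifz (a b c : nat) : nat := match a with 0 => b | S _ => c end.

Lemma computable_ifz (f g h : nat -> nat) :
  computable1 f -> computable1 g -> computable1 h ->
  computable1 (fun n => ifz (f n) (g n) (h n)).
Proof.
  intros Hf Hg Hh.
  refine (computable_ext _ _ _
    (computable_rec g (fun p => h (leftn p)) (fun n => n) f Hg _ computable_id Hf)).
  - intros n; simpl; destruct (f n); simpl; now rewrite ?leftn_pairn.
  - apply (computable_comp h); auto using computable_left, computable_id.
Qed.

Lemma computable_pred (f : nat -> nat) :
  computable1 f -> computable1 (fun n => pred (f n)).
Proof.
  intros Hf.
  refine (computable_ext _ _ _
    (computable_rec (fun _ => 0) (fun p => leftn (rightn p)) (fun n => n) f
      (computable_const 0) _ computable_id Hf)).
  - intros n; destruct (f n); simpl; now rewrite ?rightn_pairn, ?leftn_pairn.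
  - auto using computable_left, computable_right, computable_id.
Qed.

Lemma computable_sub (f g : nat -> nat) :
  computable1 f -> computable1 g -> computable1 (fun n => f n - g n).
Proof.
  intros Hf Hg.
  refine (computable_ext _ _ _
    (computable_rec (fun a => a) (fun p => pred (rightn (rightn p))) f g
      computable_id _ Hf Hg)).
  - intros n; induction (g n) as [|k IH]; simpl; [lia|].
    rewrite !rightn_pairn, IH; lia.
  - auto using computable_pred, computable_right, computable_id.
Qed.

Lemma computable_iter (t f m : nat -> nat) :
  computable1 t -> computable1 f -> computable1 m ->
  computable1 (fun n => Nat.iter (m n) t (f n)).
Proof.
  intros Ht Hf Hm.
  refine (computable_ext _ _ _
    (computable_rec (fun a => a) (fun p => t (rightn (rightn p))) f m
      computable_id _ Hf Hm)).
  - intros n; induction (m n) as [|k IH]; simpl; [reflexivity|].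
    now rewrite !rightn_pairn, IH.
  - apply (computable_comp t); auto using computable_right, computable_id.
Qed.

Ltac computability :=
  repeat first
    [ assumption
    | apply computable_const
    | apply computable_id
    | apply computable_succ
    | apply computable_pair
    | apply computable_left
    | apply computable_right
    | apply computable_ifz
    | apply computable_pred
    | apply computable_sub
    | match goal with
      | H : computable1 ?t |- computable1 (fun n => ?t _) =>
          apply (computable_comp t _ H)
      end ].

(** * Semidecidable predicates *)

(** A predicate is semidecidable when it is the projection of a decidable one;
    the decision procedure [t] answers zero for yes. *)
Definition semidec (P : nat -> Prop) : Prop :=
  exists t, computable1 t /\ forall n, P n <-> exists s, t (pairn n s) = 0.

Definition semidec2 (R : nat -> nat -> Prop) : Prop :=
  semidec (fun n => R (leftn n) (rightn n)).

Definition semidec3 (R : nat -> nat -> nat -> Prop) : Prop :=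
  semidec (fun n => R (leftn n) (leftn (rightn n)) (rightn (rightn n))).

Lemma semidec_ext (P Q : nat -> Prop) :
  (forall n, P n <-> Q n) -> semidec P -> semidec Q.
Proof.
  intros E (t & Ht & H); exists t; split; [exact Ht|].
  intros n; now rewrite <- E.
Qed.

Lemma semidec_eq (f g : nat -> nat) :
  computable1 f -> computable1 g -> semidec (fun n => f n = g n).
Proof.
  intros Hf Hg.
  exists (fun p => ifz (f (leftn p) - g (leftn p)) (g (leftn p) - f (leftn p)) 1).
  split; [computability|].
  intros n; setoid_rewrite leftn_pairn; unfold ifz.
  split; [intros E; exists 0 | intros [_ E]];
    destruct (f n - g n) eqn:?; lia.
Qed.

Lemma semidec_and (P Q : nat -> Prop) :
  semidec P -> semidec Q -> semidec (fun n => P n /\ Q n).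
Proof.
  intros (t & Ht & HP) (r & Hr & HQ).
  exists (fun p => ifz (t (pairn (leftn p) (leftn (rightn p))))
                    (r (pairn (leftn p) (rightn (rightn p)))) 1).
  split; [computability|].
  intros n; rewrite HP, HQ; split.
  - intros [[s Hs] [s' Hs']]; exists (pairn s s').
    now rewrite rightn_pairn, !leftn_pairn, rightn_pairn, Hs, Hs'.
  - intros [s Hs]; rewrite leftn_pairn, rightn_pairn in Hs.
    destruct (t _) eqn:E in Hs; [simpl in Hs; eauto | discriminate].
Qed.

Lemma semidec_or (P Q : nat -> Prop) :
  semidec P -> semidec Q -> semidec (fun n => P n \/ Q n).
Proof.
  intros (t & Ht & HP) (r & Hr & HQ).
  exists (fun p => ifz (t p) 0 (r p)).
  split; [computability|].
  intros n; rewrite HP, HQ; split.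
  - intros [[s Hs]|[s Hs]]; exists s; rewrite Hs; [easy|].
    now destruct (t _).
  - intros [s Hs]; destruct (t _) eqn:E in Hs; eauto.
Qed.

Lemma semidec_ex (P : nat -> nat -> Prop) :
  semidec2 P -> semidec (fun n => exists y, P n y).
Proof.
  intros (t & Ht & HP).
  exists (fun p => t (pairn (pairn (leftn p) (leftn (rightn p))) (rightn (rightn p)))).
  split; [computability|].
  intros n; split.
  - intros [y Hy]; specialize (HP (pairn n y)); rewrite leftn_pairn, rightn_pairn in HP.
    apply HP in Hy; destruct Hy as [s Hs]; exists (pairn y s).
    now rewrite rightn_pairn, !leftn_pairn, rightn_pairn.
  - intros [s Hs]; rewrite leftn_pairn, rightn_pairn in Hs.
    specialize (HP (pairn n (leftn s))); rewrite leftn_pairn, rightn_pairn in HP.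
    exists (leftn s); apply HP; eauto.
Qed.

Lemma semidec_comp (P : nat -> Prop) (f : nat -> nat) :
  semidec P -> computable1 f -> semidec (fun n => P (f n)).
Proof.
  intros (t & Ht & HP) Hf.
  exists (fun p => t (pairn (f (leftn p)) (rightn p))).
  split; [computability|].
  intros n; rewrite HP; setoid_rewrite leftn_pairn; now setoid_rewrite rightn_pairn.
Qed.

Lemma semidec2_comp (R : nat -> nat -> Prop) (f g : nat -> nat) :
  semidec2 R -> computable1 f -> computable1 g -> semidec (fun n => R (f n) (g n)).
Proof.
  intros HR Hf Hg.
  apply (semidec_ext (fun n => R (leftn (pairn (f n) (g n))) (rightn (pairn (f n) (g n))))).
  - intros n; now rewrite leftn_pairn, rightn_pairn.
  - apply (semidec_comp (fun n => R (leftn n) (rightn n))); [exact HR | computability].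
Qed.

Ltac semidecidability :=
  unfold semidec2, semidec3; cbv beta;
  repeat first
    [ assumption
    | apply semidec_or
    | apply semidec_and
    | apply semidec_ex; unfold semidec2; cbv beta
    | match goal with
      | H : semidec2 ?R |- semidec (fun n => ?R _ _) => apply (semidec2_comp R _ _ H)
      | H : semidec ?P |- semidec (fun n => ?P _) => apply (semidec_comp P _ H)
      end
    | apply semidec_eq ];
  computability.

Lemma least_zero (f : nat -> nat) (s : nat) :
  f s = 0 -> exists m, f m = 0 /\ forall z, z < m -> exists k, f z = S k.
Proof.
  induction s as [s IH] using lt_wf_ind; intros Hs.
  destruct (classic (exists z, z < s /\ f z = 0)) as [(z & Hz & E)|N].
  - exact (IH z Hz E).
  - exists s; split; [exact Hs|]; intros z Hz.
    destruct (f z) as [|k] eqn:E; [|eauto].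
    exfalso; eauto.
Qed.

Lemma eval_Mu_total (c : code) (f : nat -> nat) (n y : nat) :
  (forall x, eval c x (f x)) ->
  eval (Mu c) n y <->
  f (pairn n y) = 0 /\ forall z, z < y -> exists k, f (pairn n z) = S k.
Proof.
  intros Hc; simpl; unfold mu_graph; split; intros [H0 Hlt]; split.
  - exact (eval_fun _ _ _ _ (Hc _) H0).
  - intros z Hz; destruct (Hlt z Hz) as [k Hk].
    exists k; exact (eval_fun _ _ _ _ (Hc _) Hk).
  - rewrite <- H0; apply Hc.
  - intros z Hz; destruct (Hlt z Hz) as [k Hk]; exists k; rewrite <- Hk; apply Hc.
Qed.

Lemma semidec2_ce (R : nat -> nat -> Prop) : semidec2 R -> ce_rel R.
Proof.
  intros (t & [c Hc] & HR); exists (encode (Mu c)); intros x y.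
  specialize (HR (pairn x y)); rewrite leftn_pairn, rightn_pairn in HR.
  rewrite HR; unfold W; split.
  - intros [s Hs]; exists (Mu c); split; [reflexivity|].
    destruct (least_zero (fun s => t (pairn (pairn x y) s)) s Hs) as (m & Hm).
    exists m; now apply (eval_Mu_total c t).
  - intros (d & E & s & Hs); apply encode_inj in E; subst d.
    apply (eval_Mu_total c t) in Hs; [|assumption]; now exists s.
Qed.

(** * Inductive definitions are semidecidable *)

(** The least set that contains 0 and is closed under the rules of [R], where
    [R x a b] lets [x] be inferred from the premises [a] and [b]. As 0 is
    always present, it serves to fill in for missing premises. *)
Inductive closure (R : nat -> nat -> nat -> Prop) : nat -> Prop :=
| closure_0 : closure R 0
| closure_rule x a b : R x a b -> closure R a -> closure R b -> closure R x.

(** A proof checker. A state is a pair of a stack of goals and a certificate.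
    The empty stack is 0 and [S (pairn x r)] has top [x]. The certificate is a
    stream of justifications [pairn (pairn a b) s], namely the two premises and
    the reason [s] why the rule, tested by [t], applies. The goal 0 needs no
    justification. A step that fails leaves the state unchanged. *)
Definition check_step (t : nat -> nat) (st : nat) : nat :=
  let x := leftn (pred (leftn st)) in
  let r := rightn (pred (leftn st)) in
  let q := rightn st in
  let a := leftn (leftn (leftn q)) in
  let b := rightn (leftn (leftn q)) in
  let s := rightn (leftn q) in
  ifz (leftn st) st
    (ifz x (pairn r q)
      (ifz (t (pairn (pairn x (pairn a b)) s))
        (pairn (S (pairn a (S (pairn b r)))) (rightn q)) st)).

Lemma check_step_0 (t : nat -> nat) (r q : nat) :
  check_step t (pairn (S (pairn 0 r)) q) = pairn r q.
Proof.
  unfold check_step; rewrite !leftn_pairn, !rightn_pairn; simpl.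
  now rewrite leftn_pairn, rightn_pairn.
Qed.

Lemma check_step_rule (t : nat -> nat) (x a b s r q : nat) :
  x <> 0 -> t (pairn (pairn x (pairn a b)) s) = 0 ->
  check_step t (pairn (S (pairn x r)) (pairn (pairn (pairn a b) s) q)) =
  pairn (S (pairn a (S (pairn b r)))) q.
Proof.
  intros Hx Ht; unfold check_step.
  repeat (rewrite ?leftn_pairn, ?rightn_pairn; simpl pred).
  rewrite Ht; destruct x; [easy | reflexivity].
Qed.

Lemma semidec_closure (R : nat -> nat -> nat -> Prop) :
  semidec3 R -> semidec (closure R).
Proof.
  intros (t & Ht & HR).
  assert (HR' : forall x a b, R x a b <-> exists s, t (pairn (pairn x (pairn a b)) s) = 0).
  { intros x a b; specialize (HR (pairn x (pairn a b))).
    now rewrite !rightn_pairn, !leftn_pairn, ?rightn_pairn in HR. }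
  exists (fun p => leftn (Nat.iter (leftn (rightn p)) (check_step t)
                     (pairn (S (pairn (leftn p) 0)) (rightn (rightn p))))).
  assert (Hstep : computable1 (check_step t)) by (unfold check_step; computability).
  split.
  { apply computable_left, computable_iter; computability. }
  intros x; split.
  - intros Hx.
    assert (G : forall r q', exists k q,
      Nat.iter k (check_step t) (pairn (S (pairn x r)) q) = pairn r q').
    { induction Hx as [|x a b Hr _ IHa _ IHb]; intros r q'.
      - exists 1, q'; apply check_step_0.
      - destruct (Nat.eq_dec x 0) as [->|Hx0].
        { exists 1, q'; apply check_step_0. }
        apply HR' in Hr; destruct Hr as [s Hs].
        destruct (IHb r q') as (kb & qb & Hb).
        destruct (IHa (S (pairn b r)) qb) as (ka & qa & Ha).
        exists (kb + (ka + 1)), (pairn (pairn (pairn a b) s) qa).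
        rewrite !Nat.iter_add; simpl.
        now rewrite check_step_rule, Ha, Hb. }
    destruct (G 0 0) as (k & q & H); exists (pairn k q).
    cbv beta; now rewrite !rightn_pairn, !leftn_pairn, H, leftn_pairn.
  - intros [s Hs]; revert Hs; cbv beta; rewrite leftn_pairn, rightn_pairn.
    generalize (leftn s) (rightn s); clear s; intros k q.
    (* Every goal of a stack that is eventually emptied is in the closure. *)
    assert (G : forall st, leftn (Nat.iter k (check_step t) st) = 0 ->
      forall (l : list nat), leftn st = fold_right (fun y r => S (pairn y r)) 0 l ->
      forall y, In y l -> closure R y).
    { clear x q; induction k as [|k IH]; intros st H l El y Hy.
      { destruct l; [easy|]; simpl in *; congruence. }
      rewrite Nat.iter_succ_r in H.
      destruct l as [|x l]; [easy|]; simpl in El.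
      pose proof (IH _ H) as IH'; clear IH H.
      unfold check_step in IH'; rewrite El in IH'; simpl in IH'.
      rewrite leftn_pairn, rightn_pairn in IH'.
      destruct x as [|x]; simpl in IH'.
      - rewrite leftn_pairn in IH'; destruct Hy as [<-|Hy]; [constructor|].
        exact (IH' l eq_refl y Hy).
      - destruct (t _) as [|m] eqn:E in IH'; simpl in IH'.
        + rewrite leftn_pairn in IH'.
          specialize (IH' (_ :: _ :: l) eq_refl).
          destruct Hy as [<-|Hy]; [|apply IH'; simpl; tauto].
          eapply closure_rule; [apply HR'; eexists; exact E | |];
            apply IH'; simpl; tauto.
        + exact (IH' (S x :: l) El y Hy). }
    intros H; apply (G _ H [x]); [now rewrite leftn_pairn | now left].
Qed.

(** * A universal machine *)

(** Two kinds of facts are derived: [eval_fact c n y] says that the code number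
    [c] maps [n] to [y], and [pos_fact c n y] says that it maps every
    [pairn n z] with [z < y] to a positive value. *)
Definition eval_fact (c n y : nat) : nat := S (pairn 0 (pairn c (pairn n y))).
Definition pos_fact (c n y : nat) : nat := S (pairn 1 (pairn c (pairn n y))).

Lemma eval_fact_inj (c n y c' n' y' : nat) :
  eval_fact c n y = eval_fact c' n' y' -> c = c' /\ n = n' /\ y = y'.
Proof.
  intros E; injection E as E; apply pairn_inj in E as [_ E].
  apply pairn_inj in E as [-> E]; apply pairn_inj in E; tauto.
Qed.

Lemma pos_fact_inj (c n y c' n' y' : nat) :
  pos_fact c n y = pos_fact c' n' y' -> c = c' /\ n = n' /\ y = y'.
Proof.
  intros E; injection E as E; apply pairn_inj in E as [_ E].
  apply pairn_inj in E as [-> E]; apply pairn_inj in E; tauto.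
Qed.

Lemma eval_fact_neq_pos_fact (c n y c' n' y' : nat) :
  eval_fact c n y <> pos_fact c' n' y'.
Proof. intros E; injection E as E; apply pairn_inj in E as [E _]; discriminate. Qed.

(** One disjunct for each clause of the definition of [eval], where primitive
    recursion has two, and two for the positivity facts. *)
Definition eval_rule (x a b : nat) : Prop :=
  (exists n, x = eval_fact (pairn 0 0) n 0 /\ a = 0 /\ b = 0) \/
  (exists n, x = eval_fact (pairn 1 0) n (S n) /\ a = 0 /\ b = 0) \/
  (exists n, x = eval_fact (pairn 2 0) n (leftn n) /\ a = 0 /\ b = 0) \/
  (exists n, x = eval_fact (pairn 3 0) n (rightn n) /\ a = 0 /\ b = 0) \/
  (exists f g n y z, x = eval_fact (pairn 4 (pairn f g)) n (pairn y z) /\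
     a = eval_fact f n y /\ b = eval_fact g n z) \/
  (exists f g n y z, x = eval_fact (pairn 5 (pairn f g)) n y /\
     a = eval_fact g n z /\ b = eval_fact f z y) \/
  (exists f g n y, x = eval_fact (pairn 6 (pairn f g)) (pairn n 0) y /\
     a = eval_fact f n y /\ b = 0) \/
  (exists f g n m y i, x = eval_fact (pairn 6 (pairn f g)) (pairn n (S m)) y /\
     a = eval_fact (pairn 6 (pairn f g)) (pairn n m) i /\
     b = eval_fact g (pairn n (pairn m i)) y) \/
  (exists f n y, x = eval_fact (pairn 7 f) n y /\
     a = eval_fact f (pairn n y) 0 /\ b = pos_fact f n y) \/
  (exists f n, x = pos_fact f n 0 /\ a = 0 /\ b = 0) \/
  (exists f n y k, x = pos_fact f n (S y) /\
     a = pos_fact f n y /\ b = eval_fact f (pairn n y) (S k)).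

Lemma semidec_eval_rule : semidec3 eval_rule.
Proof. unfold eval_rule, eval_fact, pos_fact; semidecidability. Qed.

Lemma eval_to_closure (c : code) (n y : nat) :
  eval c n y -> closure eval_rule (eval_fact (encode c) n y).
Proof.
  revert n y; induction c as [| | | |f IHf g IHg|f IHf g IHg|f IHf g IHg|f IHf];
    intros n y; simpl.
  - intros ->; apply (closure_rule _ _ 0 0); [|constructor..]; unfold eval_rule; left; eauto.
  - intros ->; apply (closure_rule _ _ 0 0); [|constructor..]; unfold eval_rule; do 1 right; left; eauto.
  - intros ->; apply (closure_rule _ _ 0 0); [|constructor..]; unfold eval_rule; do 2 right; left; eauto.
  - intros ->; apply (closure_rule _ _ 0 0); [|constructor..]; unfold eval_rule; do 3 right; left; eauto.
  - intros (a & b & Ha & Hb & ->).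
    eapply closure_rule; [| apply IHf, Ha | apply IHg, Hb].
    unfold eval_rule; do 4 right; left; eauto 10.
  - intros (z & Hz & Hy).
    eapply closure_rule; [| apply IHg, Hz | apply IHf, Hy].
    unfold eval_rule; do 5 right; left; eauto 10.
  - replace n with (pairn (leftn n) (rightn n)) at 3 by apply pairn_leftn_rightn.
    generalize (leftn n) (rightn n); intros a m; revert y.
    induction m as [|m IHm]; simpl; intros y.
    + intros H; eapply closure_rule; [| apply IHf, H | constructor].
      unfold eval_rule; do 6 right; left; eauto 10.
    + intros (i & Hi & H).
      eapply closure_rule; [| apply IHm, Hi | apply IHg, H].
      unfold eval_rule; do 7 right; left; eauto 12.
  - intros [H0 Hlt].
    apply (closure_rule _ _ (eval_fact (encode f) (pairn n y) 0)
             (pos_fact (encode f) n y)); [unfold eval_rule; do 8 right; left; eauto 10 | auto |].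
    clear H0; induction y as [|y IHy].
    + apply (closure_rule _ _ 0 0); [unfold eval_rule; do 9 right; left; eauto 10 | constructor..].
    + destruct (Hlt y) as [k Hk]; [lia|].
      eapply closure_rule; [| apply IHy; intros z Hz; apply Hlt; lia | apply IHf, Hk].
      unfold eval_rule; do 10 right; eauto 10.
Qed.

(** What the facts mean, when they concern the number of a code. *)
Definition fact_holds (x : nat) : Prop :=
  (forall c n y, x = eval_fact (encode c) n y -> eval c n y) /\
  (forall c n y, x = pos_fact (encode c) n y ->
     forall z, z < y -> exists k, eval c (pairn n z) (S k)).

Ltac invert_facts :=
  repeat match goal with
  | H : eval_fact _ _ _ = eval_fact _ _ _ |- _ =>
      apply eval_fact_inj in H as (? & ? & ?)
  | H : pos_fact _ _ _ = pos_fact _ _ _ |- _ =>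
      apply pos_fact_inj in H as (? & ? & ?)
  | H : eval_fact _ _ _ = pos_fact _ _ _ |- _ =>
      destruct (eval_fact_neq_pos_fact _ _ _ _ _ _ H)
  | H : pos_fact _ _ _ = eval_fact _ _ _ |- _ =>
      destruct (eval_fact_neq_pos_fact _ _ _ _ _ _ (eq_sym H))
  | H : pairn _ _ = pairn _ _ |- _ => apply pairn_inj in H as [? ?]
  end; subst; try discriminate; try lia.

Lemma closure_fact_holds (x : nat) : closure eval_rule x -> fact_holds x.
Proof.
  induction 1 as [|x a b Hr _ [Ea Pa] _ [Eb Pb]].
  { split; discriminate. }
  destruct Hr as
    [(n & -> & -> & ->) |[(n & -> & -> & ->) |[(n & -> & -> & ->) |[(n & -> & -> & ->)
    |[(f & g & n & y & z & -> & -> & ->) |[(f & g & n & y & z & -> & -> & ->)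
    |[(f & g & n & y & -> & -> & ->) |[(f & g & n & m & y & i & -> & -> & ->)
    |[(f & n & y & -> & -> & ->) |[(f & n & -> & -> & ->)
    |(f & n & y & k & -> & -> & ->)]]]]]]]]]];
  split; intros c n' y' E; invert_facts;
  try (destruct c; simpl in *; invert_facts; fail);
  try (destruct c; simpl in *; invert_facts; simpl; eauto 10; fail).
  - destruct c; simpl in *; invert_facts.
    rewrite leftn_pairn, rightn_pairn; simpl; eauto.
  - destruct c as [| | | | | |c1 c2|]; simpl in *; invert_facts.
    specialize (Ea (Prec c1 c2) _ _ eq_refl); simpl in Ea.
    rewrite leftn_pairn, rightn_pairn in *; simpl; eauto.
  - destruct c as [| | | | | | |c]; simpl in *; invert_facts.
    split; eauto.
  - intros z Hz; destruct (Nat.eq_dec z y) as [->|Hzy].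
    + exists k; eauto.
    + apply (Pa _ _ _ eq_refl); lia.
Qed.

Lemma universal_machine :
  exists U : nat -> Prop, semidec U /\
    forall c n y, eval c n y <-> U (eval_fact (encode c) n y).
Proof.
  exists (closure eval_rule); split.
  - exact (semidec_closure _ semidec_eval_rule).
  - intros c n y; split; [apply eval_to_closure|].
    intros H; now apply (closure_fact_holds _ H).
Qed.

(** The graph of a partial computable function. *)
Lemma semidec2_eval (c : code) : semidec2 (eval c).
Proof.
  destruct universal_machine as (U & HU & E).
  apply (semidec_ext (fun n => U (eval_fact (encode c) (leftn n) (rightn n)))).
  - intros n; now rewrite <- E.
  - unfold eval_fact; semidecidability.
Qed.

(** The numbering [W] is uniformly semidecidable, on numbers of codes. *)
Lemma semidec_W :
  exists t, computable1 t /\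
    forall c x, W (encode c) x <-> exists s, t (pairn (pairn (encode c) x) s) = 0.
Proof.
  destruct universal_machine as (U & HU & E).
  assert (H : semidec (fun p => exists y, U (eval_fact (leftn p) (rightn p) y))).
  { unfold eval_fact; semidecidability. }
  destruct H as (t & Ht & H); exists t; split; [exact Ht|].
  intros c x; specialize (H (pairn (encode c) x)).
  rewrite leftn_pairn, rightn_pairn in H; rewrite <- H; unfold W; split.
  - intros (d & Ed & y & Hy); apply encode_inj in Ed; subst d.
    exists y; now apply E.
  - intros [y Hy]; exists c; split; [reflexivity|]; exists y; now apply E.
Qed.

(** * Distributive lattices presented by generators and relations *)

(** Terms are natural numbers. A pair tagged 1 or 2 is the meet or the join of
    two terms, and every other number is an atom. The atoms [bot_t] and [top_t]
    stand for the bounds, and [gen n] are further atoms. Tag 0 is avoided for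
    compound terms, to make them larger than their parts. *)
Definition meet_t (x y : nat) : nat := pairn 1 (pairn x y).
Definition join_t (x y : nat) : nat := pairn 2 (pairn x y).
Definition is_atom (t : nat) : Prop := leftn t <> 1 /\ leftn t <> 2.
Definition bot_t : nat := pairn 0 0.
Definition top_t : nat := pairn 0 1.
Definition gen (n : nat) : nat := pairn 3 n.

Lemma gen_inj (m n : nat) : gen m = gen n -> m = n.
Proof. intros E; now apply pairn_inj in E. Qed.

Lemma gen_neq_bot (n : nat) : gen n <> bot_t.
Proof. intros E; apply pairn_inj in E as [E _]; discriminate. Qed.

Lemma gen_neq_top (n : nat) : gen n <> top_t.
Proof. intros E; apply pairn_inj in E as [E _]; discriminate. Qed.

Lemma top_neq_bot : top_t <> bot_t.
Proof. intros E; apply pairn_inj in E as [_ E]; discriminate. Qed.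

Lemma is_atom_pairn (i n : nat) : i <> 1 -> i <> 2 -> is_atom (pairn i n).
Proof. intros H1 H2; unfold is_atom; now rewrite leftn_pairn. Qed.

Lemma is_atom_gen (n : nat) : is_atom (gen n).
Proof. now apply is_atom_pairn. Qed.

Lemma is_atom_top : is_atom top_t.
Proof. now apply is_atom_pairn. Qed.

Lemma lt_pairn_r (i n : nat) : 0 < i -> n < pairn i n.
Proof. pose proof (Cantor.to_nat_spec i n); nia. Qed.

Lemma le_pairn (a b : nat) : a <= pairn a b /\ b <= pairn a b.
Proof. pose proof (Cantor.to_nat_spec a b); nia. Qed.

Lemma term_ind (P : nat -> Prop) :
  (forall t, is_atom t -> P t) ->
  (forall x y, P x -> P y -> P (meet_t x y)) ->
  (forall x y, P x -> P y -> P (join_t x y)) ->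
  forall t, P t.
Proof.
  intros Hatom Hmeet Hjoin t; induction t as [t IH] using lt_wf_ind.
  destruct (classic (is_atom t)) as [Ht|Ht]; [auto|].
  assert (Hsub : forall i x y, 0 < i -> t = pairn i (pairn x y) -> P x /\ P y).
  { intros i x y Hi ->; pose proof (lt_pairn_r i (pairn x y) Hi).
    pose proof (le_pairn x y); split; apply IH; lia. }
  assert (Et : t = pairn (leftn t) (pairn (leftn (rightn t)) (rightn (rightn t))))
    by now rewrite !pairn_leftn_rightn.
  unfold is_atom in Ht.
  destruct (Nat.eq_dec (leftn t) 1) as [E|E].
  - rewrite E in Et; destruct (Hsub 1 _ _ ltac:(lia) Et).
    rewrite Et; now apply Hmeet.
  - destruct (Nat.eq_dec (leftn t) 2) as [E'|E']; [|tauto].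
    rewrite E' in Et; destruct (Hsub 2 _ _ ltac:(lia) Et).
    rewrite Et; now apply Hjoin.
Qed.

(** The preorder of the bounded distributive lattice generated by the atoms
    subject to the relations [Q]. *)
Inductive pres_le (Q : nat -> nat -> Prop) : nat -> nat -> Prop :=
| pres_rel x y : Q x y -> pres_le Q x y
| pres_refl x : pres_le Q x x
| pres_trans x y z : pres_le Q x y -> pres_le Q y z -> pres_le Q x z
| pres_bot x : pres_le Q bot_t x
| pres_top x : pres_le Q x top_t
| pres_lb_l x y : pres_le Q (meet_t x y) x
| pres_lb_r x y : pres_le Q (meet_t x y) y
| pres_glb x y z : pres_le Q z x -> pres_le Q z y -> pres_le Q z (meet_t x y)
| pres_ub_l x y : pres_le Q x (join_t x y)
| pres_ub_r x y : pres_le Q y (join_t x y)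
| pres_lub x y z : pres_le Q x z -> pres_le Q y z -> pres_le Q (join_t x y) z
| pres_distr x y z :
    pres_le Q (meet_t x (join_t y z)) (join_t (meet_t x y) (meet_t x z)).

Lemma pres_meet_l (Q : nat -> nat -> Prop) (x y z : nat) :
  pres_le Q x z -> pres_le Q (meet_t x y) z.
Proof. apply pres_trans, pres_lb_l. Qed.

Lemma pres_meet_r (Q : nat -> nat -> Prop) (x y z : nat) :
  pres_le Q y z -> pres_le Q (meet_t x y) z.
Proof. apply pres_trans, pres_lb_r. Qed.

Lemma pres_join_l (Q : nat -> nat -> Prop) (x y z : nat) :
  pres_le Q z x -> pres_le Q z (join_t x y).
Proof. intros H; exact (pres_trans _ _ _ _ H (pres_ub_l _ _ _)). Qed.

Lemma pres_join_r (Q : nat -> nat -> Prop) (x y z : nat) :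
  pres_le Q z y -> pres_le Q z (join_t x y).
Proof. intros H; exact (pres_trans _ _ _ _ H (pres_ub_r _ _ _)). Qed.

Create HintDb pres.
#[local] Hint Resolve pres_refl pres_bot pres_top pres_glb pres_lub pres_distr
  pres_meet_l pres_meet_r pres_join_l pres_join_r : pres.

Definition le_fact (x y : nat) : nat := S (pairn x y).

Lemma le_fact_inj (x y x' y' : nat) :
  le_fact x y = le_fact x' y' -> x = x' /\ y = y'.
Proof. intros E; injection E as E; now apply pairn_inj. Qed.

Definition pres_rule (Q : nat -> nat -> Prop) (f a b : nat) : Prop :=
  (exists x y, f = le_fact x y /\ Q x y /\ a = 0 /\ b = 0) \/
  (exists x, f = le_fact x x /\ a = 0 /\ b = 0) \/
  (exists x y z, f = le_fact x z /\ a = le_fact x y /\ b = le_fact y z) \/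
  (exists x, f = le_fact bot_t x /\ a = 0 /\ b = 0) \/
  (exists x, f = le_fact x top_t /\ a = 0 /\ b = 0) \/
  (exists x y, f = le_fact (meet_t x y) x /\ a = 0 /\ b = 0) \/
  (exists x y, f = le_fact (meet_t x y) y /\ a = 0 /\ b = 0) \/
  (exists x y z, f = le_fact z (meet_t x y) /\ a = le_fact z x /\ b = le_fact z y) \/
  (exists x y, f = le_fact x (join_t x y) /\ a = 0 /\ b = 0) \/
  (exists x y, f = le_fact y (join_t x y) /\ a = 0 /\ b = 0) \/
  (exists x y z, f = le_fact (join_t x y) z /\ a = le_fact x z /\ b = le_fact y z) \/
  (exists x y z,
     f = le_fact (meet_t x (join_t y z)) (join_t (meet_t x y) (meet_t x z)) /\
     a = 0 /\ b = 0).

Lemma semidec_pres_le (Q : nat -> nat -> Prop) :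
  semidec2 Q -> semidec2 (pres_le Q).
Proof.
  intros HQ.
  assert (HR : semidec3 (pres_rule Q)).
  { unfold pres_rule, le_fact, meet_t, join_t, bot_t, top_t; semidecidability. }
  assert (HC := semidec_closure _ HR).
  apply (semidec_ext (fun n => closure (pres_rule Q) (le_fact (leftn n) (rightn n)))).
  2: { apply (semidec_comp (closure (pres_rule Q))); [exact HC|].
       unfold le_fact; computability. }
  intros n; generalize (leftn n) (rightn n); clear n; intros x y; split.
  - assert (G : forall f, closure (pres_rule Q) f ->
      forall x y, f = le_fact x y -> pres_le Q x y); [|eauto].
    clear x y; induction 1 as [|f a b Hr _ IHa _ IHb]; [discriminate|].
    intros x y ->; unfold pres_rule in Hr.
    repeat destruct Hr as [Hr|Hr]; decompose [ex and] Hr; clear Hr; subst;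
      match goal with
      | E : le_fact _ _ = le_fact _ _ |- _ => apply le_fact_inj in E as [-> ->]
      end;
      first [solve [auto using pres_rel with pres] | eapply pres_trans; eauto].
  - induction 1 as
      [x y HQxy|x|x y z _ IHxy _ IHyz|x|x|x y|x y|x y z _ IHx _ IHy
      |x y|x y|x y z _ IHx _ IHy|x y z].
    3: apply (closure_rule _ _ _ _ ) with (2 := IHxy) (3 := IHyz).
    8: apply (closure_rule _ _ _ _ ) with (2 := IHx) (3 := IHy).
    11: apply (closure_rule _ _ _ _ ) with (2 := IHx) (3 := IHy).
    all: try (apply (closure_rule _ _ 0 0); [|constructor..]).
    all: unfold pres_rule.
    + left; eauto 10.
    + do 1 right; left; eauto 10.
    + do 2 right; left; eauto 10.
    + do 3 right; left; eauto 10.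
    + do 4 right; left; eauto 10.
    + do 5 right; left; eauto 10.
    + do 6 right; left; eauto 10.
    + do 7 right; left; eauto 10.
    + do 8 right; left; eauto 10.
    + do 9 right; left; eauto 10.
    + do 10 right; left; eauto 10.
    + do 11 right; eauto 10.
Qed.

(** The lattice presented by [Q], for a consistent [Q]. *)
Section PresentedLattice.
  Variable Q : nat -> nat -> Prop.
  Hypothesis HQ : semidec2 Q.
  Hypothesis consistent : ~ pres_le Q top_t bot_t.

  Definition presented_prelattice : ce_prelattice.
  Proof.
    refine {| meet := meet_t; join := join_t; le := pres_le Q |}.
    - destruct (computable_pair (fun _ => 1) (fun n => n)
        (computable_const 1) computable_id) as [c Hc].
      exists c; intros x y; apply Hc.
    - destruct (computable_pair (fun _ => 2) (fun n => n)
        (computable_const 2) computable_id) as [c Hc].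
      exists c; intros x y; apply Hc.
    - exact (semidec2_ce _ (semidec_pres_le Q HQ)).
    - apply pres_refl.
    - apply pres_trans.
    - intros x x' y y' [Hx Hx'] [Hy Hy']; split; auto with pres.
    - intros x x' y y' [Hx Hx'] [Hy Hy']; split; auto with pres.
    - apply pres_lb_l.
    - apply pres_lb_r.
    - apply pres_glb.
    - apply pres_ub_l.
    - apply pres_ub_r.
    - apply pres_lub.
    - exists top_t, bot_t; intros [H _]; exact (consistent H).
  Defined.

  Definition presented_lattice : ce_bounded_prelattice :=
    {| prelattice := presented_prelattice;
       bot := bot_t; top := top_t;
       bot_le := pres_bot Q; le_top := pres_top Q |}.

  Lemma presented_distributive : distributive presented_prelattice.
  Proof.
    intros x y z; split; simpl; [apply pres_distr|].
    auto 10 with pres.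
  Qed.
End PresentedLattice.

(** * Valuations *)

(** A valuation [V] of the atoms extends to all terms. *)
Inductive sat (V : nat -> Prop) : nat -> Prop :=
| sat_atom t : is_atom t -> V t -> sat V t
| sat_meet x y : sat V x -> sat V y -> sat V (meet_t x y)
| sat_join_l x y : sat V x -> sat V (join_t x y)
| sat_join_r x y : sat V y -> sat V (join_t x y).

Lemma meet_t_not_atom (x y : nat) : ~ is_atom (meet_t x y).
Proof. unfold is_atom, meet_t; rewrite leftn_pairn; tauto. Qed.

Lemma join_t_not_atom (x y : nat) : ~ is_atom (join_t x y).
Proof. unfold is_atom, join_t; rewrite leftn_pairn; tauto. Qed.

Lemma meet_t_inj (x y x' y' : nat) : meet_t x y = meet_t x' y' -> x = x' /\ y = y'.
Proof. intros E; apply pairn_inj in E as [_ E]; now apply pairn_inj. Qed.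

Lemma join_t_inj (x y x' y' : nat) : join_t x y = join_t x' y' -> x = x' /\ y = y'.
Proof. intros E; apply pairn_inj in E as [_ E]; now apply pairn_inj. Qed.

Lemma meet_t_neq_join_t (x y x' y' : nat) : meet_t x y <> join_t x' y'.
Proof. intros E; apply pairn_inj in E as [E _]; discriminate. Qed.

Lemma sat_atom_iff (V : nat -> Prop) (t : nat) : is_atom t -> sat V t <-> V t.
Proof.
  intros Ht; split; [|now apply sat_atom].
  intros H; destruct H; auto;
    [now apply meet_t_not_atom in Ht | now apply join_t_not_atom in Ht ..].
Qed.

Lemma sat_meet_iff (V : nat -> Prop) (x y : nat) :
  sat V (meet_t x y) <-> sat V x /\ sat V y.
Proof.
  split; [|intros []; now apply sat_meet].
  intros H; remember (meet_t x y) as t eqn:E; destruct H; subst.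
  - now apply meet_t_not_atom in H.
  - now apply meet_t_inj in E as [-> ->].
  - symmetry in E; now apply meet_t_neq_join_t in E.
  - symmetry in E; now apply meet_t_neq_join_t in E.
Qed.

Lemma sat_join_iff (V : nat -> Prop) (x y : nat) :
  sat V (join_t x y) <-> sat V x \/ sat V y.
Proof.
  split; [|intros []; [now apply sat_join_l | now apply sat_join_r]].
  intros H; remember (join_t x y) as t eqn:E; destruct H; subst.
  - now apply join_t_not_atom in H.
  - now apply meet_t_neq_join_t in E.
  - apply join_t_inj in E as [-> ->]; now left.
  - apply join_t_inj in E as [-> ->]; now right.
Qed.

(** Valuations that respect the bounds and the relations, that is, the prime
    filters of the presented lattice. *)
Definition model (Q : nat -> nat -> Prop) (V : nat -> Prop) : Prop :=
  ~ V bot_t /\ V top_t /\ forall x y, Q x y -> sat V x -> sat V y.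

Lemma model_sound (Q : nat -> nat -> Prop) (V : nat -> Prop) (x y : nat) :
  model Q V -> pres_le Q x y -> sat V x -> sat V y.
Proof.
  intros (Hbot & Htop & HQ).
  assert (Abot : is_atom bot_t) by now apply is_atom_pairn.
  induction 1; rewrite ?sat_meet_iff, ?sat_join_iff, ?sat_meet_iff in *;
    try tauto.
  - eauto.
  - rewrite sat_atom_iff; tauto.
  - rewrite (sat_atom_iff _ top_t); auto using is_atom_top.
Qed.

Lemma model_consistent (Q : nat -> nat -> Prop) (V : nat -> Prop) :
  model Q V -> ~ pres_le Q top_t bot_t.
Proof.
  intros HV H; pose proof (model_sound _ _ _ _ HV H) as HS.
  destruct HV as (Hbot & Htop & _); apply Hbot.
  apply sat_atom_iff; [now apply is_atom_pairn|].
  apply HS, sat_atom; auto using is_atom_top.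
Qed.

(** A term only depends on finitely many atoms. *)
Lemma sat_support (t : nat) :
  exists X : list nat, forall V V' : nat -> Prop,
    (forall a, In a X -> V a -> V' a) -> sat V t -> sat V' t.
Proof.
  induction t as [t Ht|x y [X HX] [Y HY]|x y [X HX] [Y HY]] using term_ind.
  - exists [t]; intros V V' H; rewrite !sat_atom_iff by assumption.
    apply H; now left.
  - exists (X ++ Y); intros V V' H; rewrite !sat_meet_iff.
    intros [Hx Hy]; split; [apply (HX V) | apply (HY V)]; trivial;
      intros a Ha; apply H, in_or_app; tauto.
  - exists (X ++ Y); intros V V' H; rewrite !sat_join_iff.
    intros [Hx|Hy]; [left; apply (HX V) | right; apply (HY V)]; trivial;
      intros a Ha; apply H, in_or_app; tauto.
Qed.

(** * Meets of atoms *)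

Definition meets (m : list nat) : nat := fold_right meet_t top_t m.

Lemma sat_meets (V : nat -> Prop) (m : list nat) :
  V top_t -> Forall is_atom m -> (forall a, In a m -> V a) -> sat V (meets m).
Proof.
  intros Htop; induction 1 as [|a m Ha _ IH]; simpl; intros HV.
  - apply sat_atom; auto using is_atom_top.
  - apply sat_meet; [apply sat_atom|]; auto.
Qed.

Section MeetsOfAtoms.
  Variable Q : nat -> nat -> Prop.
  Notation "x <<= y" := (pres_le Q x y) (at level 70).

  Lemma meets_le (m : list nat) (a : nat) : In a m -> meets m <<= a.
  Proof.
    induction m as [|b m IH]; simpl; [easy|].
    intros [->|Ha]; [apply pres_lb_l|].
    apply pres_trans with (meets m); [apply pres_lb_r | auto].
  Qed.

  Lemma meets_app_l (m m' : list nat) : meets (m ++ m') <<= meets m.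
  Proof. induction m as [|a m IH]; simpl; auto with pres. Qed.

  Lemma meets_app_r (m m' : list nat) : meets (m ++ m') <<= meets m'.
  Proof. induction m as [|a m IH]; simpl; auto with pres. Qed.

  Lemma le_meets_app (m m' : list nat) (c : nat) :
    c <<= meets m -> c <<= meets m' -> c <<= meets (m ++ m').
  Proof.
    induction m as [|a m IH]; simpl; intros Hm Hm'; [assumption|].
    apply pres_glb; [|apply IH]; trivial;
      apply pres_trans with (meet_t a (meets m)); auto with pres.
  Qed.

  (** Every element is the least upper bound of the meets of atoms below it.
      The side term [c] is needed for the induction through meets. *)
  Lemma meets_dense_aux (t : nat) : forall c b,
    (forall m, Forall is_atom m -> meets m <<= t -> meet_t (meets m) c <<= b) ->
    meet_t t c <<= b.
  Proof.
    induction t as [t Ht|x y IHx IHy|x y IHx IHy] using term_ind; intros c b H.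
    - apply pres_trans with (meet_t (meets [t]) c); [simpl; auto 10 with pres|].
      apply H; [auto | simpl; auto with pres].
    - apply pres_trans with (meet_t x (meet_t y c)); [auto 10 with pres|].
      apply IHx; intros m Hm Hmx.
      apply pres_trans with (meet_t y (meet_t (meets m) c)); [auto 10 with pres|].
      apply IHy; intros m' Hm' Hmy.
      apply pres_trans with (meet_t (meets (m ++ m')) c).
      + apply pres_glb; [apply le_meets_app|]; auto 6 with pres.
      + apply H; [now apply Forall_app|].
        apply pres_glb; [apply pres_trans with (meets m) | apply pres_trans with (meets m')];
          auto using meets_app_l, meets_app_r.
    - apply pres_trans with (join_t (meet_t c x) (meet_t c y)).
      { apply pres_trans with (meet_t c (join_t x y)); auto with pres. }
      apply pres_lub.
      + apply pres_trans with (meet_t x c); [auto with pres|].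
        apply IHx; intros m Hm Hx; apply H; auto with pres.
      + apply pres_trans with (meet_t y c); [auto with pres|].
        apply IHy; intros m Hm Hy; apply H; auto with pres.
  Qed.

  Lemma meets_dense (t b : nat) :
    ~ t <<= b -> exists m, Forall is_atom m /\ meets m <<= t /\ ~ meets m <<= b.
  Proof.
    intros Htb; apply NNPP; intros N; apply Htb.
    apply pres_trans with (meet_t t top_t); [auto with pres|].
    apply meets_dense_aux; intros m Hm Hmt.
    apply pres_trans with (meets m); [auto with pres|].
    apply NNPP; intros Hmb; eauto.
  Qed.
End MeetsOfAtoms.

(** * A lattice that collapses some generators to the bounds *)

(** [K0] generators become least, [K1] generators become greatest, and the
    others are free. *)
Inductive collapse (K0 K1 : nat -> Prop) : nat -> nat -> Prop :=
| collapse_bot n : K0 n -> collapse K0 K1 (gen n) bot_t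
| collapse_top n : K1 n -> collapse K0 K1 top_t (gen n).

Section Collapse.
  Variables K0 K1 : nat -> Prop.
  Hypothesis disjoint : forall n, ~ (K0 n /\ K1 n).
  Notation "x <<= y" := (pres_le (collapse K0 K1) x y) (at level 70).

  Lemma semidec_collapse :
    semidec K0 -> semidec K1 -> semidec2 (collapse K0 K1).
  Proof.
    intros H0 H1.
    apply (semidec_ext (fun p =>
      (exists n, leftn p = gen n /\ rightn p = bot_t /\ K0 n) \/
      (exists n, leftn p = top_t /\ rightn p = gen n /\ K1 n))).
    2: { unfold gen, bot_t, top_t; semidecidability. }
    intros p; generalize (leftn p) (rightn p); clear p; intros x y; split.
    - intros [(n & -> & -> & Hn)|(n & -> & -> & Hn)]; now constructor.
    - intros [n Hn|n Hn]; eauto.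
  Qed.

  (** The least model in which the atoms of [m] hold. *)
  Definition principal (m : list nat) (t : nat) : Prop :=
    In t m \/ t = top_t \/ exists n, t = gen n /\ K1 n.

  Lemma principal_model (m : list nat) :
    (forall t, In t m -> ~ t <<= bot_t) -> model (collapse K0 K1) (principal m).
  Proof.
    intros Hin; split; [|split].
    - intros [H|[H|(n & H & _)]].
      + now apply (Hin _ H), pres_refl.
      + symmetry in H; now apply top_neq_bot.
      + symmetry in H; now apply gen_neq_bot in H.
    - right; now left.
    - intros x y [n Hn|n Hn] Hx.
      + exfalso; rewrite sat_atom_iff in Hx by apply is_atom_gen.
        destruct Hx as [H|[H|(k & H & Hk)]].
        * apply (Hin _ H), pres_rel; now constructor.
        * now apply gen_neq_top in H.
        * apply gen_inj in H as ->; exact (disjoint k (conj Hn Hk)).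
      + apply sat_atom; [apply is_atom_gen|]; right; right; eauto.
  Qed.

  (** Together with [model_sound], this characterizes the upper set of a meet of
      atoms that is not least. *)
  Lemma principal_complete (m : list nat) (t : nat) :
    sat (principal m) t -> meets m <<= t.
  Proof.
    induction 1 as [t _ Ht|x y _ IHx _ IHy|x y _ IHx|x y _ IHy]; auto with pres.
    destruct Ht as [Ht|[->|(n & -> & Hn)]].
    - now apply meets_le.
    - apply pres_top.
    - apply pres_trans with top_t; [apply pres_top|]; now apply pres_rel, collapse_top.
  Qed.

  Lemma collapse_consistent : ~ top_t <<= bot_t.
  Proof. apply (model_consistent _ (principal [])), principal_model; easy. Qed.
End Collapse.

(** * Disjoint families *)

(** Pigeonhole principle: among infinitely many lists, given by a relation, two
    contain the same elements of [X]. *)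
Lemma lists_agree (X : list nat) : forall (S : nat -> Prop) (R : nat -> list nat -> Prop),
  (forall k, exists i, k <= i /\ S i) -> (forall i, S i -> exists m, R i m) ->
  exists i j m m', i <> j /\ R i m /\ R j m' /\
    forall a, In a X -> In a m <-> In a m'.
Proof.
  induction X as [|a X IH]; intros S R HS HR.
  - destruct (HS 0) as (i & _ & Hi), (HS (i + 1)) as (j & Hij & Hj).
    destruct (HR i Hi) as [m Hm], (HR j Hj) as [m' Hm'].
    exists i, j, m, m'; repeat split; auto; try lia; easy.
  - (* Keep the lists with [a] if infinitely many [i] have one, and otherwise
       those without [a]. *)
    destruct (classic (forall k, exists i, k <= i /\ exists m, R i m /\ In a m)) as [Ha|Ha].
    + destruct (IH (fun i => exists m, R i m /\ In a m) (fun i m => R i m /\ In a m))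
        as (i & j & m & m' & Hij & [Hm Hma] & [Hm' Hma'] & Hagree); auto.
      exists i, j, m, m'; repeat split; auto;
        destruct H as [<-|H]; auto; now apply (Hagree _ H).
    + apply not_all_ex_not in Ha as [k Hk].
      destruct (IH (fun i => k <= i /\ S i) (fun i m => R i m /\ ~ In a m))
        as (i & j & m & m' & Hij & [Hm Hma] & [Hm' Hma'] & Hagree).
      * intros l; destruct (HS (k + l)) as (i & Hi & HSi).
        exists i; repeat split; auto; lia.
      * intros i [Hki HSi]; destruct (HR i HSi) as [m Hm]; exists m; split; [exact Hm|].
        intros Hma; eauto 6.
      * exists i, j, m, m'; repeat split; auto;
          destruct H as [<-|H]; try tauto; now apply (Hagree _ H).
Qed.

(** Modulo an element [b], there is no infinite family of pairwise disjoint
    elements. *)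
Lemma collapse_no_disjoint_family (K0 K1 : nat -> Prop) (b : nat) (p : nat -> nat) :
  (forall n, ~ (K0 n /\ K1 n)) ->
  (forall i, ~ pres_le (collapse K0 K1) (p i) b) ->
  exists i j, i <> j /\ ~ pres_le (collapse K0 K1) (meet_t (p i) (p j)) b.
Proof.
  intros disjoint Hp.
  set (Q := collapse K0 K1) in *.
  destruct (sat_support b) as [X HX].
  destruct (lists_agree X (fun _ => True)
    (fun i m => Forall is_atom m /\ pres_le Q (meets m) (p i) /\ ~ pres_le Q (meets m) b))
    as (i & j & m & m' & Hij & (Am & Lm & Nm) & (Am' & Lm' & Nm') & Hagree).
  - intros k; exists k; auto.
  - intros i _; apply meets_dense, Hp.
  - exists i, j; split; [exact Hij|]; intros Hb; apply Nm.
    apply principal_complete.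
    assert (Hpos : forall l, ~ pres_le Q (meets l) b ->
      forall a, In a l -> ~ pres_le Q a bot_t).
    { intros l Hl a Ha Hab; apply Hl.
      apply pres_trans with a; [now apply meets_le|].
      apply pres_trans with bot_t; auto with pres. }
    assert (HV : model Q (principal K1 (m ++ m'))).
    { apply principal_model; [assumption|]; intros a Ha.
      apply in_app_or in Ha as [Ha|Ha]; eauto. }
    (* The support of [b] does not distinguish [m ++ m'] from [m]. *)
    apply (HX (principal K1 (m ++ m'))).
    + intros a Ha [H|H]; [|now right]; left.
      apply in_app_or in H as [H|H]; [exact H | now apply Hagree].
    + apply (model_sound _ _ _ _ HV Hb), sat_meet.
      * apply (model_sound _ _ _ _ HV Lm), sat_meets; trivial; [apply HV|].
        intros a Ha; left; apply in_or_app; now left.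
      * apply (model_sound _ _ _ _ HV Lm'), sat_meets; trivial; [apply HV|].
        intros a Ha; left; apply in_or_app; now right.
Qed.

(** * The effectively inseparable lattice *)

(** The code [h] decides which of [W u] and [W v] wins the race to enumerate the
    generator owned by [u] and [v]: its value at [pairn u v] is 0 when [W u] wins
    and 1 when [W v] wins. *)
Definition decides_race (h : code) : Prop :=
  forall c d,
    let w := pairn (encode c) (encode d) in
    (W (encode c) (gen w) \/ W (encode d) (gen w) -> eval h w 0 \/ eval h w 1) /\
    (eval h w 0 -> W (encode c) (gen w)) /\
    (eval h w 1 -> W (encode d) (gen w)).

(** The race is decided by the least certificate for either of the sets. *)
Lemma race : exists h : code, decides_race h.
Proof.
  destruct semidec_W as (t & Ht & HW).
  set (tu := fun p => t (pairn (pairn (leftn (leftn p)) (gen (leftn p))) (rightn p))).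
  set (tv := fun p => t (pairn (pairn (rightn (leftn p)) (gen (leftn p))) (rightn p))).
  assert (Htu : computable1 tu) by (unfold tu, gen; computability).
  assert (Htv : computable1 tv) by (unfold tv, gen; computability).
  assert (Hs : computable1 (fun p => ifz (tu p) 0 (tv p))) by computability.
  assert (Ho : computable1 (fun p => ifz (tu p) 0 1)) by computability.
  destruct Hs as [cs Hs], Ho as [co Ho], computable_id as [ci Hi].
  exists (Comp co (Pair ci (Mu cs))); intros c d w.
  assert (Hu : W (encode c) (gen w) <-> exists s, tu (pairn w s) = 0).
  { rewrite HW; unfold tu, w; setoid_rewrite leftn_pairn; setoid_rewrite rightn_pairn.
    now setoid_rewrite leftn_pairn. }
  assert (Hv : W (encode d) (gen w) <-> exists s, tv (pairn w s) = 0).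
  { rewrite HW; unfold tv, w; setoid_rewrite leftn_pairn; now setoid_rewrite rightn_pairn. }
  assert (Hh : forall k, eval (Comp co (Pair ci (Mu cs))) w k ->
    exists s, ifz (tu (pairn w s)) 0 (tv (pairn w s)) = 0 /\ k = ifz (tu (pairn w s)) 0 1).
  { intros k (z & (a & s & Ha & Hm & ->) & Hk).
    apply (eval_fun _ _ _ _ (Hi w)) in Ha; subst a.
    apply (eval_Mu_total _ _ _ _ Hs) in Hm as [Hm _].
    exists s; split; [exact Hm|]; exact (eval_fun _ _ _ _ Hk (Ho _)). }
  split; [|split].
  - intros H.
    assert (E : exists s, ifz (tu (pairn w s)) 0 (tv (pairn w s)) = 0).
    { rewrite Hu, Hv in H; destruct H as [[s H]|[s H]]; exists s; rewrite H;
        [easy | now destruct (tu _)]. }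
    destruct E as [s0 E].
    destruct (least_zero (fun s => ifz (tu (pairn w s)) 0 (tv (pairn w s))) s0 E)
      as (s & Hm).
    assert (Hk : eval (Comp co (Pair ci (Mu cs))) w (ifz (tu (pairn w s)) 0 1)).
    { exists (pairn w s); split; [|apply Ho].
      exists w, s; split; [apply Hi | split; [|reflexivity]].
      exact (proj2 (eval_Mu_total _ _ _ _ Hs) Hm). }
    revert Hk; destruct (tu (pairn w s)); [now left | now right].
  - intros H; apply Hh in H as (s & _ & E); apply Hu; exists s.
    now destruct (tu (pairn w s)).
  - intros H; apply Hh in H as (s & E & E'); apply Hv; exists s.
    destruct (tu (pairn w s)); [discriminate E' | exact E].
Qed.

Lemma semidec_eval_value (h : code) (k : nat) : semidec (fun w => eval h w k).
Proof.
  pose proof (semidec2_eval h) as H.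
  apply (semidec2_comp (eval h) (fun w => w) (fun _ => k) H); computability.
Qed.

Section Inseparable.
  Variable h : code.
  Let K0 (w : nat) : Prop := eval h w 1.
  Let K1 (w : nat) : Prop := eval h w 0.

  Lemma outcomes_disjoint (w : nat) : ~ (K0 w /\ K1 w).
  Proof. intros [H0 H1]; discriminate (eval_fun _ _ _ _ H0 H1). Qed.

  (** Generators won by [W u] become greatest and those won by [W v] become
      least. *)
  Definition race_lattice : ce_bounded_prelattice :=
    presented_lattice (collapse K0 K1)
      (semidec_collapse K0 K1 (semidec_eval_value h 1) (semidec_eval_value h 0))
      (collapse_consistent K0 K1 outcomes_disjoint).

  Lemma race_lattice_ei : decides_race h -> ei_prelattice race_lattice.
  Proof.
    intros Hh; split.
    - intros x [[Hx _] [_ Hx']].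
      apply (collapse_consistent K0 K1 outcomes_disjoint), (pres_trans _ _ x); assumption.
    - destruct (computable_pair (fun _ => 3) (fun n => n)
        (computable_const 3) computable_id) as [cg Hg].
      exists cg; intros u v Hu Hv Hdisj.
      exists (gen (pairn u v)); split; [apply Hg|].
      (* [W u] and [W v] are not empty, so [u] and [v] number codes. *)
      destruct (Hu bot_t) as (c & <- & _); [split; apply pres_refl|].
      destruct (Hv top_t) as (d & <- & _); [split; apply pres_refl|].
      destruct (Hh c d) as (Hrace & H0 & H1); intros H.
      set (w := pairn (encode c) (encode d)) in *.
      destruct (Hrace H) as [E|E]; apply (Hdisj (gen w)); split; auto.
      (* The generator is collapsed into the class covered by the loser. *)
      + apply Hv; split; [apply pres_top | now apply pres_rel, collapse_top].
      + apply Hu; split; [now apply pres_rel, collapse_bot | apply pres_bot].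
  Qed.
End Inseparable.

(** * The lattice generated by infinitely many disjoint elements *)

(** The relations that make the generators pairwise disjoint. *)
Inductive disjoint_gens : nat -> nat -> Prop :=
| disjoint_gens_intro i j : i <> j -> disjoint_gens (meet_t (gen i) (gen j)) bot_t.

Lemma semidec_disjoint_gens : semidec2 disjoint_gens.
Proof.
  apply (semidec_ext (fun p => exists i j k,
    leftn p = meet_t (gen i) (gen j) /\ rightn p = bot_t /\
    (i - j = S k \/ j - i = S k))).
  2: { unfold meet_t, gen, bot_t; semidecidability. }
  intros p; generalize (leftn p) (rightn p); clear p; intros x y; split.
  - intros (i & j & k & -> & -> & H); constructor; lia.
  - intros [i j Hij]; exists i, j, (pred ((i - j) + (j - i))).
    repeat split; lia.
Qed.

(** The valuation for which [gen i] is the only true generator. *)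
Lemma disjoint_gens_model (i : nat) :
  model disjoint_gens (fun t => t = gen i \/ t = top_t).
Proof.
  split; [|split].
  - intros [H|H]; symmetry in H; [now apply gen_neq_bot in H | now apply top_neq_bot in H].
  - now right.
  - intros x y [j k Hjk] H; exfalso.
    rewrite sat_meet_iff, !sat_atom_iff in H by apply is_atom_gen.
    destruct H as [[Hj|Hj] [Hk|Hk]];
      try (now apply gen_neq_top in Hj); try (now apply gen_neq_top in Hk).
    apply gen_inj in Hj, Hk; congruence.
Qed.

Definition disjoint_lattice : ce_bounded_prelattice :=
  presented_lattice disjoint_gens semidec_disjoint_gens
    (model_consistent _ _ (disjoint_gens_model 0)).

Lemma gen_not_le_bot (i : nat) : ~ pres_le disjoint_gens (gen i) bot_t.
Proof.
  intros H; pose proof (disjoint_gens_model i) as HV.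
  apply (model_sound _ _ _ _ HV) in H.
  - rewrite sat_atom_iff in H by now apply is_atom_pairn.
    exact (proj1 HV H).
  - apply sat_atom; [apply is_atom_gen | now left].
Qed.

Theorem theorem52 :
  exists L : ce_bounded_prelattice,
    distributive L /\ ei_prelattice L /\ ~ Ld_universal L.
Proof.
  destruct race as [h Hh].
  exists (race_lattice h); split; [|split].
  - apply presented_distributive.
  - now apply race_lattice_ei.
  - intros [_ Huniv].
    destruct (Huniv disjoint_lattice (presented_distributive _ _ _))
      as (f & _ & Hle & _ & Hmeet); simpl in Hle, Hmeet.
    destruct (collapse_no_disjoint_family _ _ (f bot_t) (fun i => f (gen i))
      (outcomes_disjoint h)) as (i & j & Hij & N).
    + intros i H; apply Hle in H; exact (gen_not_le_bot i H).
    + apply N, pres_trans with (f (meet_t (gen i) (gen j))); [apply Hmeet|].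
      apply Hle, pres_rel; now constructor.
Qed.
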